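(* Let $q$ be a prime power. Assume that $(n-1)\mid(q^2-1)$ and $1\le k\le\lfloor\frac{n+q-1}{q+1}\rfloor$. If $(n-1)\mid(k+1)(q+1)$ or $(n-1)\mid k(q+1)$, then there exists an MDS linear code $C$ with parameters $[n,k+2,\ge n-k-1]_{q^2}$ such that $\dim(\mathrm{Hull}_H(C))=k+1$.
   Context: $n,k$ are positive integers. An $[n,k,d]_{q^2}$ code is a linear code over $\mathbb{F}_{q^2}$ of length $n$, dimension $k$ and minimum Hamming distance $d$; $[n,k,\ge d_0]_{q^2}$ means that the minimum distance is at least $d_0$; the code is MDS if $d=n-k+1$. The Hermitian inner product on $\mathbb{F}_{q^2}^n$ is $\langle x,y\rangle_H=\sum_i x_iy_i^q$, $C^{\perp_H}$ is the dual of $C$ with respect to it, and $\mathrm{Hull}_H(C)=C\cap C^{\perp_H}$.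
   Formalization: The formal theorem additionally assumes 2k+3 ≤ n, which the conclusion forces since the hull lies in the Hermitian dual of dimension n-k-2; without it the claim fails, e.g. q=2, n=2, k=1 asks for a 3-dimensional code of length 2. *)

(* Defs.v *)
From mathcomp Require Import all_boot all_order all_algebra.

Set Implicit Arguments.
Unset Strict Implicit.
Unset Printing Implicit Defensive.

Import GRing.Theory.
Local Open Scope ring_scope.

Definition prime_power (q : nat) : Prop :=
  exists p e : nat, [/\ prime p, (0 < e)%N & q = (p ^ e)%N].

Section Codes.

Variables (F : finFieldType) (n : nat).
Implicit Types (x y : 'rV[F]_n) (C : {vspace 'rV[F]_n}).

Definition hamming_dist x y : nat := #|[set i : 'I_n | x 0 i != y 0 i]|.

(* Relational, so that the zero code has no minimum distance at all. *)
Definition is_min_dist C (d : nat) : Prop :=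
  (exists x y, [/\ x \in C, y \in C, x != y & hamming_dist x y = d]) /\
  (forall x y, x \in C -> y \in C -> x != y -> (d <= hamming_dist x y)%N).

Definition is_code C (k d : nat) : Prop := \dim C = k /\ is_min_dist C d.

Definition is_code_ge C (k d0 : nat) : Prop :=
  exists2 d, (d0 <= d)%N & is_code C k d.

(* The truncated subtraction is harmless: \dim C <= n always holds. *)
Definition MDS C : Prop := is_min_dist C (n - \dim C + 1).

(* The inner product is only Hermitian when #|F| = q ^ 2. *)
Definition herm (q : nat) x y : F := \sum_(i < n) x 0 i * y 0 i ^+ q.

(* The vectors orthogonal to C already form a subspace, so that taking the span
   adds nothing; see mem_herm_dual. *)
Definition herm_dual (q : nat) C : {vspace 'rV[F]_n} :=
  <<enum [set x | [forall y in C, herm q x y == 0%R]]>>%VS.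

Lemma mem_herm_dual q C x :
  (x \in herm_dual q C) = [forall y in C, herm q x y == 0].
Proof.
apply/idP/idP => [xC|xP]; last by apply: memv_span; rewrite mem_enum inE.
apply/forall_inP => y yC; apply/eqP; rewrite (coord_span xC) /herm.
under eq_bigr => i _ do rewrite summxE mulr_suml.
rewrite exchange_big big1 // => j _ /=.
under eq_bigr => i _ do rewrite mxE -mulrA.
rewrite -mulr_sumr; set z := nth _ _ _.
have: z \in enum [set x | [forall y in C, herm q x y == 0]].
  by apply: mem_nth; rewrite -cardE; exact: ltn_ord.
rewrite mem_enum inE => /forall_inP /(_ y yC) /eqP.
by rewrite /herm => ->; rewrite mulr0.
Qed.

Definition herm_hull (q : nat) C : {vspace 'rV[F]_n} :=
  (C :&: herm_dual q C)%VS.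

End Codes.

(* Main.v *)
(* The codes are evaluation codes of polynomials of degree at most k+1, and the
   hull has dimension k+1 as soon as the Hermitian Gram matrix of a basis has
   rank one.  Write N = n-1.  Scaling the columns by elements of prescribed
   norm allows any weights in F_q^*.  On {0} and the N-th roots of unity mu_N,
   with weight -N at 0 and 1 on mu_N, the monomials x^i, x^j have product N
   when N | i + qj and 0 otherwise, except that the product of 1 with itself is
   cancelled; the divisibility hypotheses leave a single nonzero entry, unless
   k = 1 and N | q+1.

   In that exceptional case one needs a code of dimension 3 and hull dimension
   2, for which other point sets or weights are used: points of F_q if
   N < q+1; if N = q+1, weights on mu_N whose Fourier coefficients vanish at
   -2, ..., 2 (q odd, or 3 | q+1), the conic mu_N together with its nucleus
   (q even, 3 not dividing q+1), and an explicit code for q = 3. *)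
Require Import Defs.
From mathcomp Require Import all_boot all_order all_algebra all_solvable all_field.
From mathcomp Require Import zify ring.

Set Implicit Arguments.
Unset Strict Implicit.
Unset Printing Implicit Defensive.

Import GRing.Theory.
Local Open Scope ring_scope.

(** * Roots of unity and norms in a field with [q ^ 2] elements *)

Section FiniteField.

Variables (F : finFieldType) (q : nat).
Hypothesis cF : #|F| = (q ^ 2)%N.

Lemma card_gt1_base : (1 < q)%N.
Proof. by have := finNzRing_gt1 F; rewrite cF; case: q => [|[|]]. Qed.

Lemma expf_card_pred (x : F) : x != 0 -> x ^+ (q ^ 2 - 1) = 1.
Proof.
have q1 := card_gt1_base.
move=> x0; apply: (mulIf x0).
by rewrite -exprSr mul1r subn1 prednK ?expn_gt0 ?(ltnW q1) // -cF expf_card.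
Qed.

Lemma exists_prim_root N : (N %| q ^ 2 - 1)%N -> exists z : F, N.-primitive_root z.
Proof.
have q1 := card_gt1_base.
have Q0 : (0 < q ^ 2 - 1)%N by nia.
move=> dN; pose rs := [seq x : F <- enum F | x != 0].
have urs : uniq rs by rewrite filter_uniq ?enum_uniq.
have : has (q ^ 2 - 1).-primitive_root rs.
  apply: has_prim_root => //.
    apply/allP => x; rewrite mem_filter => /andP[x0 _].
    by rewrite unity_rootE expf_card_pred.
  rewrite size_filter; have := count_predC (pred1 (0 : F)) (enum F).
  rewrite -cardE cF (count_uniq_mem _ (enum_uniq _)) mem_enum /=.
  by rewrite (eq_count (a2 := [pred x : F | x != 0])) //; lia.
case/hasP => g _ gP; exists (g ^+ ((q ^ 2 - 1) %/ N)).
exact: dvdn_prim_root.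
Qed.

(** For a generator [g] of the unit group, [g ^+ e] is fixed by the [q]-power map only if [q.+1]
    divides [e], because [q ^ 2 - 1] factors as [q.+1 * (q - 1)]. *)
Lemma norm_surj (x : F) : x ^+ q = x -> exists v, v ^+ q.+1 = x.
Proof.
have q1 := card_gt1_base.
case: (eqVneq x 0) => [->|x0 xq]; first by exists 0; rewrite expr0n.
have [g gP] := exists_prim_root (dvdnn _).
case/(prim_rootP gP): (expf_card_pred x0) => [[e _]] /= xe.
have : (q ^ 2 - 1 %| e * (q - 1))%N.
  rewrite (prim_order_dvd gP) exprM -xe; apply/eqP/(mulIf x0).
  by rewrite -exprSr mul1r subn1 prednK ?(ltnW q1).
rewrite (_ : q ^ 2 - 1 = q.+1 * (q - 1))%N; last by nia.
rewrite dvdn_pmul2r ?subn_gt0 // => /dvdnP[d de].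
by exists (g ^+ d); rewrite -exprM -de -xe.
Qed.

End FiniteField.

(** * MDS codes whose Hermitian Gram matrix has rank one *)

Section RankOneGram.

Variables (F : finFieldType) (m n : nat).
Implicit Type A : 'M[F]_(m.+1, n).

Definition row_map A : 'Hom('rV[F]_m.+1, 'rV[F]_n) := linfun (mulmxr A).

Definition row_code A : {vspace 'rV[F]_n} := limg (row_map A).

Lemma row_codeP A x :
  reflect (exists u : 'rV_m.+1, x = u *m A) (x \in row_code A).
Proof.
apply: (iffP memv_imgP) => [[u _ ->]|[u ->]]; exists u; rewrite ?lfunE //=.
exact: memvf.
Qed.

(** Nonzero codewords have weight at least [n - m], which is the MDS condition in dimension
    [m.+1]. *)
Definition few_zeros A :=
  forall u : 'rV_m.+1, u != 0 -> leq #|[set l | (u *m A) 0 l == 0]| m.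

Lemma few_zeros_inj A (u : 'rV_m.+1) :
  (m < n)%N -> few_zeros A -> u *m A = 0 -> u = 0.
Proof.
move=> mn zA uA; apply/eqP; case: (eqVneq u 0) => // /zA.
rewrite uA (_ : [set _ | _] = setT) ?cardsT ?card_ord; first by lia.
by apply/setP => l; rewrite !inE mxE eqxx.
Qed.

Lemma few_zeros_lker0 A :
  (m < n)%N -> few_zeros A -> lker (row_map A) = 0%VS.
Proof.
move=> mn zA; apply/eqP; rewrite -subv0; apply/subvP => u.
rewrite memv_ker lfunE /= => /eqP uA.
by rewrite memv0 (few_zeros_inj mn zA uA).
Qed.

Lemma few_zeros_dim A : (m < n)%N -> few_zeros A -> \dim (row_code A) = m.+1.
Proof.
move=> mn zA; rewrite /row_code limg_dim_eq; last by rewrite few_zeros_lker0 ?capv0.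
by rewrite dimvf /dim /= mul1n.
Qed.

Lemma few_zeros_min_dist A :
  (m < n)%N -> few_zeros A -> is_min_dist (row_code A) (n - m).
Proof.
move=> mn zA.
have lower x y : x \in row_code A -> y \in row_code A -> x != y ->
    (n - m <= hamming_dist x y)%N.
  move=> /row_codeP[u ->] /row_codeP[v ->] xy.
  have /zA : u - v != 0 by apply: contraNneq xy => /eqP; rewrite subr_eq0 => /eqP->.
  have -> : [set l | ((u - v) *m A) 0 l == 0]
          = ~: [set l | (u *m A) 0 l != (v *m A) 0 l].
    by apply/setP => l; rewrite !inE negbK mulmxBl !mxE subr_eq0.
  rewrite cardsCs setCK card_ord /hamming_dist.
  by move: #|_| => d; lia.
split=> //.
(* Singleton bound: m linear conditions on m+1 coordinates. *)
pose B : 'M_(m.+1, m) := colsub (widen_ord (ltnW mn)) A.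
have /rowV0Pn[u uB u0] : kermx B != 0.
  by rewrite kermx_eq0 /row_free; have := rank_leq_col B; lia.
have {uB}/sub_kermxP uB := uB.
exists (u *m A), 0.
have uA0 : u *m A != 0 by apply: contra_neq u0; apply: few_zeros_inj.
have C0 : 0 \in row_code A by apply: mem0v.
have CA : u *m A \in row_code A by apply/row_codeP; exists u.
split=> //; apply/eqP; rewrite eqn_leq lower // andbT.
pose Z : {set 'I_n} := [set widen_ord (ltnW mn) l | l : 'I_m].
have cZ : #|Z| = m.
  by rewrite card_imset ?card_ord // => a b /(congr1 val) /= /val_inj.
have <- : #|~: Z| = (n - m)%N by have := cardsC Z; rewrite card_ord cZ; lia.
apply/subset_leq_card/subsetP => l; rewrite !inE; apply: contraNN.
case/imsetP => j _ ->; have /rowP/(_ j) := uB; rewrite !mxE => uBj.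
by apply/eqP; rewrite -[RHS]uBj; apply: eq_bigr => i _; rewrite !mxE.
Qed.

Variable q : nat.
Hypothesis qF : [pchar F].-nat q.

Lemma sum_expq (I : Type) (r : seq I) (P : pred I) (E : I -> F) :
  (\sum_(i <- r | P i) E i) ^+ q = \sum_(i <- r | P i) E i ^+ q.
Proof.
apply: (big_morph (fun x => x ^+ q)) => [x y|]; first exact: exprDn_pchar.
by case/andP: qF; case: (q) => // d _ _; rewrite expr0n.
Qed.

(** The form on codewords factors through the functional [u *m y] on messages, so the hull is the
    image of the hyperplane on which this functional vanishes. *)
Lemma herm_hull_row_code A (lam : F) (y : 'cV_m.+1) :
  (m < n)%N -> few_zeros A -> lam != 0 -> y != 0 ->
  (forall i j, herm q (row i A) (row j A) = lam * y i 0 * y j 0 ^+ q) ->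
  \dim (herm_hull q (row_code A)) = m.
Proof.
move=> mn zA lam0 y0 gramA.
have hermE (u v : 'rV_m.+1) :
    herm q (u *m A) (v *m A) = lam * (u *m y) 0 0 * (v *m y) 0 0 ^+ q.
  rewrite [(u *m y) 0 0]mxE [(v *m y) 0 0]mxE -mulrA mulr_suml mulr_sumr /herm.
  under [LHS]eq_bigr => l _ do rewrite !mxE sum_expq mulr_suml.
  rewrite exchange_big; apply: eq_bigr => i _ /=.
  under [LHS]eq_bigr => l _ do rewrite mulr_sumr.
  rewrite exchange_big sum_expq !mulr_sumr; apply: eq_bigr => j _ /=.
  have -> : lam * (u 0 i * y i 0 * (v 0 j * y j 0) ^+ q)
          = u 0 i * v 0 j ^+ q * (lam * y i 0 * y j 0 ^+ q).
    by rewrite exprMn; ring.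
  rewrite -gramA /herm mulr_sumr; apply: eq_bigr => l _.
  by rewrite !mxE exprMn; ring.
have q_gt0 : (0 < q)%N by case/andP: qF.
pose K := lker (linfun (mulmxr y) : 'Hom('rV_m.+1, 'M_1)).
have inK u : (u \in K) = ((u *m y) 0 0 == 0).
  rewrite memv_ker lfunE /=; apply/eqP/eqP => [->|uy0]; first by rewrite mxE.
  by apply/matrixP => i j; rewrite !ord1 uy0 mxE.
have [i0 yi0] : exists i, y i 0 != 0.
  apply/existsP; apply: contraNT y0 => /existsPn y0; apply/eqP/matrixP => i j.
  by rewrite ord1 mxE; apply/eqP; have := y0 i; rewrite negbK.
have deltaK i : ((delta_mx 0 i : 'rV_m.+1) *m y) 0 0 = y i 0 by rewrite -rowE mxE.
have dimK : \dim K = m.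
  have := limg_ker_dim (linfun (mulmxr y) : 'Hom('rV_m.+1, 'M_1)) fullv.
  rewrite capfv dimvf /dim /= mul1n -/K.
  set L := limg _.
  have L1 : (\dim L <= 1)%N.
    by rewrite (leq_trans (dimvS (subvf _))) // dimvf /dim /= muln1.
  suff : (0 < \dim L)%N by lia.
  rewrite lt0n dimv_eq0; apply/eqP => L0.
  have : (delta_mx 0 i0 *m y) \in L.
    by apply/memv_imgP; exists (delta_mx 0 i0); rewrite ?memvf ?lfunE.
  rewrite L0 memv0 => /eqP/matrixP/(_ 0 0); rewrite deltaK mxE => /eqP.
  by rewrite (negbTE yi0).
have -> : herm_hull q (row_code A) = (row_map A @: K)%VS.
  apply/vspaceP => x; apply/memv_capP/memv_imgP.
    case=> /row_codeP[u ->]; rewrite mem_herm_dual => /forall_inP H.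
    exists u; last by rewrite lfunE.
    (* Testing against the single row [i0] suffices, since [y i0 0] is nonzero. *)
    have /H : delta_mx 0 i0 *m A \in row_code A.
      by apply/row_codeP; exists (delta_mx 0 i0).
    rewrite hermE deltaK inK !mulf_eq0 (negbTE lam0) expf_eq0.
    by rewrite (negbTE yi0) andbF orbF.
  case=> u; rewrite inK lfunE /= => /eqP uy ->; split.
    by apply/row_codeP; exists u.
  rewrite mem_herm_dual; apply/forall_inP => z /row_codeP[v ->].
  by rewrite hermE uy mulr0 mul0r.
by rewrite limg_dim_eq // few_zeros_lker0 ?capv0.
Qed.

(* Scaling column l by an element of norm w l turns the weighted Gram matrix
   into the Hermitian one. *)
Lemma weighted_code A (w : 'I_n -> F) (lam : F) (y : 'cV_m.+1) :
  #|F| = (q ^ 2)%N -> (m < n)%N -> few_zeros A ->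
  (forall l, w l != 0) -> (forall l, w l ^+ q = w l) ->
  lam != 0 -> y != 0 ->
  (forall i j, \sum_l w l * (A i l * A j l ^+ q) = lam * y i 0 * y j 0 ^+ q) ->
  exists C : {vspace 'rV[F]_n},
    [/\ is_code_ge C m.+1 (n - m), MDS C & \dim (herm_hull q C) = m].
Proof.
move=> cF mn zA w0 wq lam0 y0 gramA.
have /fin_all_exists[v vE] l : exists v, v ^+ q.+1 = w l.
  exact: norm_surj.
pose B := \matrix_(i, l) (A i l * v l).
have v0 l : v l != 0.
  by apply: contraNneq (w0 l) => v0; rewrite -vE v0 expr0n.
have uB (u : 'rV_m.+1) l : (u *m B) 0 l = (u *m A) 0 l * v l.
  by rewrite !mxE mulr_suml; apply: eq_bigr => i _; rewrite mxE mulrA.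
have zB : few_zeros B.
  move=> u /zA; rewrite (_ : [set l | (u *m A) 0 l == 0] = [set l | (u *m B) 0 l == 0]) //.
  by apply/setP => l; rewrite !inE uB mulf_eq0 (negbTE (v0 l)) orbF.
have dimB := few_zeros_dim mn zB; have distB := few_zeros_min_dist mn zB.
exists (row_code B); split.
- by exists (n - m)%N; rewrite // /is_code dimB.
- by rewrite /MDS dimB (_ : n - m.+1 + 1 = n - m)%N //; lia.
apply: (herm_hull_row_code mn zB lam0 y0) => i j.
rewrite -gramA; apply: eq_bigr => l _.
by rewrite !mxE -vE exprMn exprS; ring.
Qed.

End RankOneGram.

(** * Arithmetic of the divisibility hypotheses *)

Section ExponentCases.

Local Open Scope nat_scope.

Implicit Types q N k : nat.

(** These are the Gram entries that survive summation over the [N]-th roots of unity. A weight at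
    the point 0 can cancel the one at (0, 0). *)
Definition diag_exponents q N k d := forall i j, (i <= k + 1) -> (j <= k + 1) ->
  (N %| i + q * j) = ((i == 0) && (j == 0)) || ((i == d) && (j == d)).

(** Modulo [M] the number [q] is -1, so [i + q * j] is congruent to [i - j]. *)
Lemma dvdn_conj_exponents q M i j :
  (M %| q.+1) -> (M %| i + q * j) -> (i < M) -> (j < M) -> i = j.
Proof.
move=> Mq Mij iM jM.
have Mqj : (M %| q.+1 * j) by rewrite dvdn_mulr.
case: (leqP j i) => ij.
  have : (M %| i - j).
    by rewrite -(dvdn_addl _ Mqj) (_ : i - j + q.+1 * j = i + q * j) //; lia.
  by case: (posnP (i - j)) => [|d0 /dvdn_leq]; lia.
have : (M %| j - i).
  by rewrite -(dvdn_addr _ Mij) (_ : i + q * j + (j - i) = q.+1 * j) //; lia.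
by case: (posnP (j - i)) => [|d0 /dvdn_leq]; lia.
Qed.

Lemma dvdn_conj_exponentsE q M i j :
  M %| q.+1 -> i < M -> j < M -> (M %| i + q * j) = (i == j).
Proof.
move=> Mq iM jM; apply/idP/eqP => [|->]; first by move/dvdn_conj_exponents; apply.
by rewrite -mulSn dvdn_mulr.
Qed.

(** Here [M] is the gcd of [N] and [q.+1]. Reduction modulo [M] excludes off-diagonal pairs; on the
    diagonal [N] divides [i * q.+1] exactly when [d] divides [i], and [2 * d] is out of range. *)
Lemma diag_exponents_coprime q N k M c d :
  N = (M * d) -> q.+1 = (M * c) -> coprime d c ->
  (k + 1 < M) -> (0 < d <= k + 1) -> (k + 1 < 2 * d) -> diag_exponents q N k d.
Proof.
move=> NE qE dc kM /andP[d0 dk] kd i j ik jk.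
have M0 : (0 < M) by lia.
have [ij|ij] := eqVneq i j.
  rewrite -{}ij -mulSn qE NE -mulnA dvdn_pmul2l // Gauss_dvdr // !andbb.
  apply/idP/orP => [/dvdnP[e ie]|[/eqP->|/eqP->]]; rewrite ?dvdn0 ?dvdnn //.
  have : (e < 2) by nia.
  by case: e ie => [|[|e]] // ->; [left | right; rewrite mul1n].
have -> : ((i == 0) && (j == 0)) || ((i == d) && (j == d)) = false by lia.
apply: contraNF ij => Nij; apply/eqP/(@dvdn_conj_exponents q M); try lia.
  by rewrite qE dvdn_mulr.
by apply: dvdn_trans Nij; rewrite NE dvdn_mulr.
Qed.

Lemma dvd_pred_sqr q N d : (1 < q) ->
  N = (q.+1 * d) -> (N %| q ^ 2 - 1) -> (d <= q - 1).
Proof.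
move=> q1 ->; rewrite (_ : q ^ 2 - 1 = q.+1 * (q - 1)); last by nia.
by rewrite dvdn_pmul2l // => /dvdn_leq; apply; rewrite subn_gt0.
Qed.

(** The bound on [k * q.+1] controls the quotient [m] in either divisibility: it forces [k = 1] once
    [m] is at least 3 in the first, or at least 2 in the second. *)
Lemma exponent_cases q N k :
  (1 < q) -> (0 < k) -> (k * q.+1 <= N + q) -> (2 * k + 2 <= N) ->
  (N %| q ^ 2 - 1) -> (N %| (k + 1) * q.+1) \/ (N %| k * q.+1) ->
  (k = 1 /\ (N %| q.+1)) \/
  exists2 d, (0 < d <= k + 1) & diag_exponents q N k d.
Proof.
move=> q1 k0 kN room dvdN; case=> /dvdnP[m mE].
  have [m1|m1] := eqVneq m 1.
    right; exists (k + 1); first lia.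
    apply: (@diag_exponents_coprime _ _ _ q.+1 1); rewrite ?coprimen1 //; try lia.
    have : (k + 1 <= q - 1) by apply: (@dvd_pred_sqr q N) => //; lia.
    by lia.
  have [m2|m2] := eqVneq m 2.
    subst m.
    have : (k < 3) by nia.
    case: k k0 kN room mE => [|[|[|k']]] // _ kN room mE _.
      by left; split=> //; rewrite (_ : N = q.+1) //; lia.
    right; exists 3 => //.
    have [M qM] : exists M, q.+1 = (2 * M) by exists (q.+1)./2; lia.
    apply: (@diag_exponents_coprime _ _ _ M 2) => //; try lia.
    have /dvdnP[e eE] := dvdN.
    have NE : N = (3 * M) by lia.
    (* Both sides are [q ^ 2 - 1]; hence 3 divides [M - 1], and [M] exceeds 3. *)
    have : (M * (4 * (M - 1)) = M * (3 * e)) by nia.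
    by move/eqP; rewrite eqn_pmul2l; [move/eqP; lia | lia].
  have k1 : k = 1.
    have : (2 < m) by case: m mE m1 m2 => [|[|[|]]] // ; nia.
    by nia.
  subst k; have [Nq|Nq] := boolP (N %| q.+1); first by left.
  right; exists 2 => //.
  have N2 : (2 %| N).
    rewrite dvdn2; apply: contraNN Nq => No.
    rewrite -(@Gauss_dvdr _ 2) ?coprimen2 //.
    by apply/dvdnP; exists m; lia.
  have /dvdnP[M NE] := N2; have qE : q.+1 = (M * m) by nia.
  have mo : odd m.
    apply: contraNT Nq => me; apply/dvdnP; exists (m./2).
    by rewrite qE NE -{1}(even_halfK me); lia.
  (* The coprime criterion needs [2 < M]. For [M = 2] one has [N = 4] and [q] congruent to 1 modulo
     4, so the exponent is [i + j] modulo 4. *)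
  have [M2|M2] := eqVneq M 2.
    move=> i j; have {}NE : N = 4 by lia.
    have [t qt] : exists t, q = (4 * t + 1) by exists (q %/ 4); lia.
    rewrite NE qt mulnDl mul1n addnCA addnC -mulnA dvdn_addl ?dvdn_mulr //.
    by case: i => [|[|[|]]] //; case: j => [|[|[|]]].
  by apply: (@diag_exponents_coprime _ _ _ M m); rewrite ?coprime2n //; lia.
have [m1|m1] := eqVneq m 1.
  have [k1|k1] := eqVneq k 1.
    by left; split=> //; rewrite (_ : N = q.+1) //; nia.
  right; exists k; first lia.
  apply: (@diag_exponents_coprime _ _ _ q.+1 1); rewrite ?coprimen1 //; try lia.
  have : (k <= q - 1) by apply: (@dvd_pred_sqr q N) => //; lia.
  by lia.
left; have k1 : k = 1.
  have : (1 < m) by case: m mE m1 => [|[|]] //; nia.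
  by nia.
by split=> //; apply/dvdnP; exists m; lia.
Qed.

End ExponentCases.

(** * Codes on roots of unity and one further point *)

Section Points.

Variable F : finFieldType.

(** A nonzero polynomial of degree at most [m] has at most [m] roots. *)
Lemma vandermonde_few_zeros m n (x : 'I_n -> F) :
  injective x -> few_zeros (\matrix_(i < m.+1, l < n) x l ^+ i).
Proof.
move=> xI u u0; set Z := [set l | _].
pose p := \poly_(i < m.+1) u 0 (inord i).
have pE l : p.[x l] = (u *m (\matrix_(i, l) x l ^+ i)) 0 l.
  rewrite horner_poly mxE; apply: eq_bigr => i _.
  by rewrite inord_val mxE.
have p0 : p != 0.
  apply: contra_neq u0 => p0; apply/rowP => i; rewrite mxE.
  by have := coef_poly m.+1 (fun i => u 0 (inord i)) i; rewrite -/p p0 coef0 ltn_ord inord_val.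
have : (size [seq x l | l in Z] < size p)%N.
  apply: max_poly_roots => //.
    by apply/allP => _ /mapP[l + ->]; rewrite mem_enum inE -pE rootE.
  by rewrite map_inj_uniq ?enum_uniq.
rewrite size_map -cardE => /leq_trans/(_ (size_poly _ _)).
by rewrite ltnS.
Qed.

Lemma sum_prim_root N (z : F) e : N.-primitive_root z ->
  \sum_(l < N) z ^+ (l * e) = if (N %| e)%N then N%:R else 0.
Proof.
move=> zN; under eq_bigr => l _ do rewrite mulnC exprM.
rewrite (prim_order_dvd zN); case: eqVneq => [->|ze].
  by under eq_bigr => l _ do rewrite expr1n; rewrite sumr_const card_ord.
apply: (mulfI (_ : z ^+ e - 1 != 0)); first by rewrite subr_eq0.
by rewrite -subrX1 mulr0 -exprM mulnC exprM (prim_expr_order zN) expr1n subrr.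
Qed.

Definition circle0 N (z : F) (l : 'I_N.+1) : F :=
  if unlift ord0 l is Some j then z ^+ j else 0.

Lemma prim_root_neq0 N (z : F) : N.-primitive_root z -> z != 0.
Proof.
move=> zN; apply/eqP => z0; have := prim_expr_order zN.
by rewrite z0 expr0n gtn_eqF ?(prim_order_gt0 zN) // => /eqP; rewrite eq_sym oner_eq0.
Qed.

Lemma prim_root_inj N (z : F) : N.-primitive_root z ->
  injective (fun l : 'I_N => z ^+ l).
Proof.
move=> zN i j /eqP; rewrite (eq_prim_root_expr zN) !modn_small //.
by move/eqP/val_inj.
Qed.

Lemma circle0_inj N (z : F) : N.-primitive_root z -> injective (@circle0 N z).
Proof.
move=> zN i j; have z0 := prim_root_neq0 zN; rewrite /circle0.
case: (unliftP ord0 i) => [i'|] ->; case: (unliftP ord0 j) => [j'|] ->.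
all: rewrite ?liftK ?unlift_none //.
- by move/(prim_root_inj zN) ->.
- by move/eqP; rewrite expf_eq0 (negbTE z0) andbF.
- by move/esym/eqP; rewrite expf_eq0 (negbTE z0) andbF.
Qed.

Variable q : nat.
Hypotheses (qF : [pchar F].-nat q) (cF : #|F| = (q ^ 2)%N).

(** The point 0 contributes only to the product of the constant monomial with itself, whence the
    [w0] term. *)
Lemma circle0_code m N (z w0 lam : F) (w : 'I_N -> F) (i0 : 'I_m.+1) :
  N.-primitive_root z -> (m < N.+1)%N -> w0 != 0 -> w0 ^+ q = w0 ->
  (forall l, w l != 0) -> (forall l, w l ^+ q = w l) -> lam != 0 ->
  (forall i j : 'I_m.+1, w0 *+ ((i == 0%N :> nat) && (j == 0%N :> nat))
     + \sum_l w l * z ^+ (l * (i + q * j)) = lam *+ ((i == i0) && (j == i0))) ->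
  exists C : {vspace 'rV[F]_N.+1},
    [/\ is_code_ge C m.+1 (N.+1 - m), MDS C & \dim (herm_hull q C) = m].
Proof.
move=> zN mN w00 w0q wn0 wq lam0 gram.
have q0 : (0 < q)%N by case/andP: qF.
pose W (l : 'I_N.+1) := if unlift ord0 l is Some j then w j else w0.
apply: (weighted_code (w := W) (lam := lam) (y := delta_mx i0 0) qF cF mN
  (vandermonde_few_zeros (circle0_inj zN))) => //.
- by move=> l; rewrite /W; case: unlift.
- by move=> l; rewrite /W; case: unlift.
- apply/eqP => /matrixP/(_ i0 0); rewrite !mxE !eqxx => /eqP.
  by rewrite oner_eq0.
move=> i j; rewrite !mxE !andbT big_ord_recl /W unlift_none !mxE /circle0.
rewrite unlift_none -exprM !expr0n muln_eq0 (gtn_eqF q0) orbF.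
under eq_bigr => l _ do rewrite liftK !mxE liftK -!exprM -exprD -mulnDr (mulnC (val j)).
rewrite -natrM mulnb mulr_natr gram.
by case: (i == i0); case: (j == i0); rewrite ?expr1n ?expr0n ?(gtn_eqF q0) ?mulr0 ?mulr1 ?mul0r.
Qed.

Lemma natr_expq n : (n%:R : F) ^+ q = n%:R.
Proof.
elim: n => [|n IHn]; last by rewrite -addn1 natrD exprDn_pchar // IHn expr1n.
by case/andP: qF => q0 _; rewrite expr0n (gtn_eqF q0).
Qed.

Lemma diag_exponents_code N k d :
  (N %| q ^ 2 - 1)%N -> (2 * k + 2 <= N)%N -> (0 < d <= k + 1)%N ->
  diag_exponents q N k d ->
  exists C : {vspace 'rV[F]_N.+1},
    [/\ is_code_ge C (k + 1).+1 (N.+1 - (k + 1)), MDS C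
      & \dim (herm_hull q C) = (k + 1)%N].
Proof.
move=> /(exists_prim_root cF)[z zN] kN /andP[d0 dk] diag.
have N0 : N%:R != 0 :> F by rewrite (prim_root_natf_neq0 zN).
have dk' : (d < (k + 1).+1)%N by [].
apply: (@circle0_code _ _ z (- N%:R) N%:R (fun=> 1) (Ordinal dk') zN) => //.
- by lia.
- by rewrite oppr_eq0.
- by rewrite exprNn_pchar // natr_expq.
- by move=> _; rewrite oner_eq0.
- by move=> _; rewrite expr1n.
move=> i j; under eq_bigr => l _ do rewrite mul1r.
have eqd (l : 'I_(k + 1).+1) : (l == Ordinal dk') = (l == d :> nat) by [].
rewrite !eqd (sum_prim_root _ zN) (diag i j) -1?ltnS //.
case: (eqVneq (i : nat) 0%N) => [->|_]; last by rewrite add0r /=; case: (_ && _).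
case: (eqVneq (j : nat) 0%N) => [_|_]; last by rewrite add0r /=; case: (_ && _).
by rewrite (ltn_eqF d0) addNr.
Qed.

Lemma dvd_succ_dvd_pred_sqr N : (N %| q.+1)%N -> (N %| q ^ 2 - 1)%N.
Proof.
have q1 := card_gt1_base cF; rewrite (_ : q ^ 2 - 1 = q.+1 * (q - 1))%N; last by nia.
exact: dvdn_mulr.
Qed.

(** The signs [z ^+ (l * N./2)] have their only Fourier coefficient at [N./2], out of reach of
    [i - j] because [N./2] is at least 3. The point 0 then supplies the sole Gram entry. *)
Lemma even_circle_code N : (N %| q.+1)%N -> ~~ odd N -> (6 <= N)%N ->
  exists C : {vspace 'rV[F]_N.+1},
    [/\ is_code_ge C 3 (N.+1 - 2), MDS C & \dim (herm_hull q C) = 2].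
Proof.
move=> Nq Ne N6; have [z zN] := exists_prim_root cF (dvd_succ_dvd_pred_sqr Nq).
have z0 := prim_root_neq0 zN.
have NE : N = (N./2 * 2)%N by rewrite muln2 even_halfK.
have qo : odd q.
  have : (2 %| q.+1)%N by apply: dvdn_trans Nq; rewrite dvdn2.
  by rewrite dvdn2 /= negbK.
apply: (@circle0_code 2 _ z 1 1 (fun l => z ^+ (l * N./2)) ord0 zN).
- by lia.
- exact: oner_neq0.
- exact: expr1n.
- by move=> l; rewrite expf_neq0.
- move=> l; have w2 : (z ^+ (l * N./2)) ^+ 2 = 1.
    by rewrite -exprM -mulnA -NE mulnC exprM (prim_expr_order zN) expr1n.
  by rewrite -{1}[q]odd_double_half qo exprD -mul2n (exprM _ 2) w2 expr1n mulr1.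
- exact: oner_neq0.
move=> i j; under eq_bigr => l _ do rewrite -exprD -mulnDr addnA.
rewrite (sum_prim_root _ zN) dvdn_conj_exponentsE //; try by case: i j => [i iP] [j jP] /=; lia.
rewrite (_ : (N./2 + i == j)%N = false) ?addr0 //.
by case: i j => [i iP] [j jP] /=; lia.
Qed.

Lemma char2_of_even : ~~ odd q -> 2 \in [pchar F].
Proof.
rewrite -dvdn2 => q2; have := pnat_dvd q2 qF.
by rewrite pnatE.
Qed.

(** With [x = z ^+ l] the weight is the trace of [z * x ^+ 3], whose Fourier coefficients sit at 3
    and -3; for [N] at least 6 these avoid all differences [i - j]. *)
Lemma cubic_circle_code N :
  (N %| q.+1)%N -> ~~ odd q -> (3 %| N)%N -> (6 <= N)%N ->
  exists C : {vspace 'rV[F]_N.+1},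
    [/\ is_code_ge C 3 (N.+1 - 2), MDS C & \dim (herm_hull q C) = 2].
Proof.
move=> Nq qe N3 N6; have [z zN] := exists_prim_root cF (dvd_succ_dvd_pred_sqr Nq).
have c2 := char2_of_even qe.
pose u (l : 'I_N) := z ^+ (1 + l * 3).
have un l : u l ^+ q.+1 = 1.
  by apply/eqP; rewrite -exprM -(prim_order_dvd zN) dvdn_mull.
apply: (@circle0_code 2 _ z 1 1 (fun l => u l + u l ^+ q) ord0 zN).
- by lia.
- exact: oner_neq0.
- exact: expr1n.
(* A zero trace would give [u l ^+ 2 = 1], hence 3 would divide [1 + l * 3]; the factor [z] in [u]
   serves to exclude this. *)
- move=> l; apply/eqP => w0.
  have /eqP : u l * (u l + u l ^+ q) = 0 by rewrite w0 mulr0.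
  rewrite mulrDr -exprS un -expr2 addr_eq0 oppr_pchar2 // -exprM.
  rewrite -(prim_order_dvd zN) => /(dvdn_trans N3); rewrite Gauss_dvdl //.
  by rewrite dvdn_addl ?dvdn_mull.
- by move=> l; rewrite exprDn_pchar // -(exprM (u l)) mulnn -cF expf_card addrC.
- exact: oner_neq0.
move=> i j.
have -> : \sum_l (u l + u l ^+ q) * z ^+ (l * (i + q * j))
  = z * (\sum_(l < N) z ^+ (l * (3 + i + q * j)))
  + z ^+ q * (\sum_(l < N) z ^+ (l * (i + q * (j + 3)))).
  rewrite !mulr_sumr -big_split; apply: eq_bigr => l _ /=.
  rewrite mulrDl -exprM -!exprD -exprS; congr (_ ^+ _ + _ ^+ _); ring.
rewrite !(sum_prim_root _ zN) !dvdn_conj_exponentsE //;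
  try by case: i j => [i iP] [j jP] /=; lia.
have -> : (3 + i == j)%N = false by case: i j => [i iP] [j jP] /=; lia.
have -> : (i == j + 3 :> nat)%N = false by case: i j => [i iP] [j jP] /=; lia.
by rewrite !mulr0 !addr0.
Qed.

(* In characteristic 2 the point (0:1:0) is the nucleus of the conic
   (1:a:a^2): every line through it meets the conic once. *)
Lemma nucleus_code N :
  (N %| q.+1)%N -> ~~ odd q -> coprime N 3 -> (4 <= N)%N ->
  exists C : {vspace 'rV[F]_N.+1},
    [/\ is_code_ge C 3 (N.+1 - 2), MDS C & \dim (herm_hull q C) = 2].
Proof.
move=> Nq qe N3 N4; have [z zN] := exists_prim_root cF (dvd_succ_dvd_pred_sqr Nq).
have c2 := char2_of_even qe.
have a11 := addrr_pchar2 c2 (1 : F).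
have No : odd N.
  by rewrite (dvdn_odd Nq) //= qe.
have N1 : N%:R = 1 :> F.
  by rewrite -[N]odd_double_half No natrD -muln2 natrM (pcharf0 c2) mulr0 addr0.
pose A := \matrix_(i < 3, l < N.+1)
  if unlift ord0 l is Some l' then (z ^+ l') ^+ i else (i == 1%N :> nat)%:R.
(* The constant 1 yields the diagonal of the Gram matrix and the trace of [x ^+ 2] the entries (0,
   2) and (2, 0). The nucleus cancels (1, 1), which leaves the rank-one matrix of the vector (1, 0,
   1). *)
pose v (l : 'I_N) := 1 + z ^+ (l * 2) + z ^+ (l * 2) ^+ q.
pose w (l : 'I_N.+1) := if unlift ord0 l is Some l' then v l' else 1.
have v0 l : v l != 0.
  apply/eqP; rewrite /v; set b := z ^+ _ => b0.
  have bq : b * b ^+ q = 1.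
    by apply/eqP; rewrite -exprS -exprM -(prim_order_dvd zN) dvdn_mull.
  (* As [b ^+ q] is the inverse of [b], a zero of [v] is a cube root of unity; [N] being prime to 3,
     it is 1, where [v] equals 1. *)
  have b3 : b ^+ 3 = 1.
    have bE : b + b * b + 1 = 0 by rewrite -bq -{1}[b]mulr1 -!mulrDr b0 mulr0.
    apply/eqP; rewrite -subr_eq0 (_ : b ^+ 3 - 1 = (b - 1) * (b + b * b + 1)); last by ring.
    by rewrite bE mulr0.
  have b1 : b = 1.
    apply/eqP; rewrite -(prim_order_dvd zN) -(Gauss_dvdl _ N3) (prim_order_dvd zN).
    by rewrite exprM -/b b3.
  have := b0; rewrite b1 expr1n (addrr_pchar2 c2) add0r => /eqP.
  by rewrite oner_eq0.
have AE (u : 'rV_3) l : (u *m A) 0 l = if unlift ord0 l is Some l'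
    then (u *m \matrix_(i < 3, l < N) (z ^+ l) ^+ i) 0 l' else u 0 1.
  rewrite mxE; case: (unliftP ord0 l) => [l'|] El.
    by rewrite mxE; apply: eq_bigr => j _; rewrite !mxE El liftK.
  rewrite El !big_ord_recl big_ord0 !mxE unlift_none /= !mulr0 mulr1 add0r !addr0.
  by congr (u 0 _); apply: val_inj.
have VE := vandermonde_few_zeros (m := 2) (prim_root_inj zN).
have zA : few_zeros A.
  move=> u u0; set Z := [set l | _].
  pose Z' := [set l | (u *m \matrix_(i < 3, l < N) (z ^+ l) ^+ i) 0 l == 0].
  have ZE : #|Z| = ((u 0 1 == 0)%R + #|Z'|)%N.
    rewrite (cardsD1 ord0) inE AE unlift_none; congr (_ + _)%N.
    rewrite -(card_imset Z' (@lift_inj _ ord0)); apply: eq_card => l.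
    rewrite !inE AE; case: (unliftP ord0 l) => [l'|] ->.
      by rewrite eq_sym neq_lift mem_imset ?inE //; apply: lift_inj.
    by rewrite eqxx; apply/esym/imsetP => -[l' _ /eqP]; rewrite (negbTE (neq_lift _ _)).
  rewrite ZE; have := VE u u0; rewrite -/Z'; case: eqVneq => // u1 _.
  (* A word vanishing at the nucleus is a polynomial in [x ^+ 2]; squaring is injective in
     characteristic 2, so it has at most one zero on the conic. *)
  rewrite add1n ltnS leqNgt; apply/negP => /card_gt1P[a [b [aZ bZ ab]]].
  have EV l : (u *m \matrix_(i < 3, l < N) (z ^+ l) ^+ i) 0 l
      = u 0 0 + u 0 1 * z ^+ l + u 0 (inord 2) * (z ^+ l) ^+ 2.
    rewrite mxE !big_ord_recl big_ord0 !mxE expr0 expr1 mulr1 addr0 addrA.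
    by congr (u 0 _ + u 0 _ * _ + u 0 _ * _); apply: val_inj; rewrite //= inordK.
  move: aZ bZ; rewrite !inE !EV u1 !mul0r !addr0 => /eqP az /eqP bz.
  have u2 : u 0 (inord 2) = 0.
    have : u 0 (inord 2) * (z ^+ a - z ^+ b) ^+ 2 == 0.
      rewrite (_ : _ * _ = (u 0 0 + u 0 (inord 2) * (z ^+ a) ^+ 2)
          - (u 0 0 + u 0 (inord 2) * (z ^+ b) ^+ 2)
          + (1 + 1) * (u 0 (inord 2) * (z ^+ b) * (z ^+ b - z ^+ a))); last by ring.
      by rewrite az bz a11 mul0r subrr addr0.
    rewrite mulf_eq0 expf_eq0 subr_eq0 (inj_eq (prim_root_inj zN)) (negbTE ab).
    by rewrite orbF => /eqP.
  move: az; rewrite u2 mul0r addr0 => u00; case/eqP: u0; apply/rowP => i; rewrite mxE.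
  case: i => [[|[|[|//]]] iP].
  - by rewrite -[RHS]u00; congr (u 0 _); apply: val_inj.
  - by rewrite -[RHS]u1; congr (u 0 _); apply: val_inj.
  - by rewrite -[RHS]u2; congr (u 0 _); apply: val_inj; rewrite /= inordK.
apply: (weighted_code (w := w) (lam := 1)
  (y := \col_i (i != 1%N :> nat)%:R) qF cF _ zA) => //.
- by lia.
- by move=> l; rewrite /w; case: unlift => // ; rewrite oner_neq0.
- move=> l; rewrite /w; case: unlift => [l'|]; last by rewrite expr1n.
  rewrite /v !exprDn_pchar // expr1n -[_ ^+ q ^+ q]exprM mulnn -cF expf_card.
  by rewrite addrAC.
- by rewrite oner_neq0.
- apply/eqP => /colP/(_ 0); rewrite !mxE => /eqP; by rewrite oner_eq0.
move=> i j; rewrite big_ord_recl /w unlift_none !mxE unlift_none mul1r.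
rewrite !natr_expq mul1r -!natrM !mulnb.
under eq_bigr => l _ do rewrite liftK !mxE liftK.
have -> : \sum_(l < N) v l * (z ^+ l ^+ i * z ^+ l ^+ j ^+ q)
  = (\sum_(l < N) z ^+ (l * (i + q * j))) + (\sum_(l < N) z ^+ (l * (i + 2 + q * j)))
  + (\sum_(l < N) z ^+ (l * (i + q * (j + 2)))).
  rewrite -!big_split; apply: eq_bigr => l _ /=.
  rewrite -!exprM -exprD /v !mulrDl mul1r -!exprM -!exprD.
  congr (_ ^+ _ + _ ^+ _ + _ ^+ _); ring.
rewrite !(sum_prim_root _ zN) !dvdn_conj_exponentsE //;
  try by case: i j => [i iP] [j jP] /=; lia.
rewrite N1.
by case: i j => [[|[|[|//]]] iP] [[|[|[|//]]] jP] /=; rewrite ?add0r ?addr0.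
Qed.

End Points.

(** * The exceptional case [q = 3] *)

Section SmallField.

Variable F : finFieldType.
Hypothesis cF : #|F| = (3 ^ 2)%N.

(** For [N = 4] the alternating signs fail, since [N./2 = 2] is a difference [i - j]. Unit weights
    on a different point set work instead. *)
Lemma card9_code :
  exists C : {vspace 'rV[F]_5},
    [/\ is_code_ge C 3 (5 - 2), MDS C & \dim (herm_hull 3 C) = 2].
Proof.
have c3 : 3 \in [pchar F] := card_finPcharP cF isT.
have qF : [pchar F].-nat 3 by rewrite pnatE.
have [z zN] := exists_prim_root cF (dvdnn _).
have z4 : z ^+ 4 = -1.
  apply/eqP; have : (z ^+ 4 - 1) * (z ^+ 4 + 1) == 0.
    by rewrite -subr_sqr expr1n -exprM (prim_expr_order zN) subrr.
  by rewrite mulf_eq0 subr_eq0 -(prim_order_dvd zN) addr_eq0.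
have three : 3%:R = 0 :> F := pcharf0 c3.
(* x runs over 0, 1, -1, z, -z; writing -1 as z^4 makes injectivity arithmetic mod 8. *)
pose e := [:: 0; 4; 1; 5]%N.
pose x (l : 'I_5) := if unlift ord0 l is Some l' then z ^+ (nth 0 e l') else 0.
have xI : injective x.
  move=> i j; have z0 := prim_root_neq0 zN; rewrite /x.
  case: (unliftP ord0 i) => [i'|] ->; case: (unliftP ord0 j) => [j'|] ->.
  all: rewrite ?liftK ?unlift_none //.
  - move/eqP; rewrite (eq_prim_root_expr zN) => h; congr (lift _ _); move: h.
    by case: i' j' => [[|[|[|[|//]]]] i4] [[|[|[|[|//]]]] j4] // _; apply: val_inj.
  - by move/eqP; rewrite expf_eq0 (negbTE z0) andbF.
  - by move/esym/eqP; rewrite expf_eq0 (negbTE z0) andbF.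
(* This is the last column of the Gram matrix, its last entry being 4 = 1. Symmetry of the points
   under negation gives the 0. *)
pose y : 'cV[F]_3 := \col_i nth 0 [:: z ^+ 2 - 1; 0; 1] i.
apply: (weighted_code (w := fun=> 1) (lam := 1) (y := y) qF cF _
  (vandermonde_few_zeros xI)) => //.
- by move=> _; rewrite oner_neq0.
- by move=> _; rewrite expr1n.
- by rewrite oner_neq0.
- apply/eqP => /colP/(_ (inord 2)); rewrite !mxE inordK // => /eqP.
  by rewrite oner_eq0.
move=> i j; rewrite big_ord_recl !big_ord_recl big_ord0 !mxE /x unlift_none !liftK /=.
case: i j => [[|[|[|//]]] iP] [[|[|[|//]]] jP] /=; rewrite ?expr0n ?expr0 ?expr1 /=.
all: try by ring: z4.
(* The entries (0, 0), (0, 2) and (2, 2) agree only modulo 3. *)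
all: apply/eqP; rewrite -subr_eq0; apply/eqP.
- by transitivity (3%:R * 3%:R : F); [ring: z4 | rewrite three mul0r].
- by transitivity (3%:R * (1 - z ^+ 2)); [ring: z4 | rewrite three mul0r].
- by transitivity (3%:R * 1 : F); [ring: z4 | rewrite three mul0r].
Qed.

End SmallField.

(** * Lagrange interpolation *)

Section Lagrange.

Variables (F : fieldType) (n : nat) (x : 'I_n -> F).
Hypothesis xI : injective x.

Definition node_poly l : {poly F} := \prod_(j < n | j != l) ('X - (x j)%:P).

Lemma node_poly_eq l k : (node_poly l).[x k] != 0 -> k = l.
Proof.
apply: contra_neq_eq => kl; rewrite horner_prod (bigD1 k) //=.
by rewrite hornerXsubC subrr mul0r.
Qed.

Lemma node_poly_neq0 l : (node_poly l).[x l] != 0.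
Proof.
rewrite horner_prod prodf_seq_neq0; apply/allP => j _; apply/implyP => jl.
by rewrite hornerXsubC subr_eq0 (inj_eq xI) eq_sym.
Qed.

Lemma size_node_poly l : size (node_poly l) = n.
Proof.
rewrite /node_poly -big_filter size_prod_XsubC size_filter -sum1_count.
by rewrite (sum1_card (predC1 l)) cardC1 card_ord prednK // (leq_ltn_trans _ (ltn_ord l)).
Qed.

(* The X^(n-1) coefficient of the Lagrange interpolation of X^s. *)
Lemma sum_node_expr s : (s < n)%N ->
  \sum_l x l ^+ s / (node_poly l).[x l] = (s == n.-1)%:R.
Proof.
move=> sn; pose L := \sum_l (x l ^+ s / (node_poly l).[x l]) *: node_poly l.
have LX : L = 'X^s.
  apply/eqP; rewrite -subr_eq0; apply: contraT => D0.
  have sD : (size (L - 'X^s)%R <= n)%N.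
    rewrite (leq_trans (size_polyD _ _)) // geq_max size_polyN size_polyXn sn andbT.
    apply: (leq_trans (size_sum _ _ _)); apply/bigmax_leqP => l _.
    by rewrite (leq_trans (size_scale_leq _ _)) ?size_node_poly.
  have := max_poly_roots (rs := [seq x l | l : 'I_n]) D0.
  rewrite size_map -cardE card_ord ltnNge sD; apply.
    apply/allP => _ /mapP[k _ ->]; rewrite rootE hornerD hornerN hornerXn horner_sum.
    rewrite (bigD1 k) //= big1 => [|l lk].
      by rewrite hornerZ divfK ?node_poly_neq0 // addr0 subrr.
    rewrite hornerZ; case: (eqVneq (node_poly l).[x k] 0) => [->|/node_poly_eq kl].
      by rewrite mulr0.
    by rewrite kl eqxx in lk.
  by rewrite map_inj_uniq ?enum_uniq.
have := congr1 (coefp n.-1) LX; rewrite /= coefXn coef_sum eq_sym => <-.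
apply: eq_bigr => l _; rewrite coefZ -[X in _`_X.-1](size_node_poly l).
have /monicP := monic_prod_XsubC (index_enum _) (fun j => j != l) x.
by rewrite /lead_coef -/(node_poly l) => ->; rewrite mulr1.
Qed.

End Lagrange.

(** * Codes with nodes in the subfield of [q] elements *)

Section Subfield.

Variables (F : finFieldType) (q : nat).
Hypotheses (qF : [pchar F].-nat q) (cF : #|F| = (q ^ 2)%N).

(* Weighting the nodes x of the subfield by x^(n-5) times the Lagrange
   denominators kills all moments of order < 4 but not the fourth one. *)
Lemma subfield_code N : (4 <= N)%N -> (N.+1 < q)%N ->
  exists C : {vspace 'rV[F]_N.+1},
    [/\ is_code_ge C 3 (N.+1 - 2), MDS C & \dim (herm_hull q C) = 2].
Proof.
move=> N4 Nq.
have dq : (q - 1 %| q ^ 2 - 1)%N.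
  by rewrite (_ : q ^ 2 - 1 = (q - 1) * q.+1)%N ?dvdn_mulr //; nia.
have [z zN] := exists_prim_root cF dq.
have z0 := prim_root_neq0 zN.
pose x (l : 'I_N.+1) := z ^+ l.
have x0 l : x l != 0 by rewrite expf_neq0.
have xI : injective x.
  move=> i j /eqP; rewrite (eq_prim_root_expr zN) !modn_small.
  - by move/eqP/val_inj.
  - by have := ltn_ord j; lia.
  - by have := ltn_ord i; lia.
have zq : z ^+ q = z.
  by rewrite -[q in LHS](@subnK 1) ?exprD ?(prim_expr_order zN) ?mul1r //; lia.
have xq l : x l ^+ q = x l by rewrite /x -exprM mulnC exprM zq.
pose w l := x l ^+ (N - 4) / (node_poly x l).[x l].
apply: (weighted_code (w := w) (lam := 1) (y := delta_mx (inord 2) 0) qF cF _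
  (vandermonde_few_zeros xI)) => //.
- by lia.
- by move=> l; rewrite mulf_neq0 ?invr_eq0 ?node_poly_neq0 // expf_neq0.
- move=> l; rewrite /w exprMn exprVn -exprM mulnC exprM xq horner_prod -prodrXl.
  congr (_ / _); apply: eq_bigr => j _; rewrite hornerXsubC.
  by rewrite exprDn_pchar // exprNn_pchar // !xq.
- by rewrite oner_neq0.
- apply/eqP => /matrixP/(_ (inord 2) 0); rewrite !mxE !eqxx => /eqP.
  by rewrite oner_eq0.
move=> i j; rewrite !mxE !andbT.
(* On the subfield the [q]-power map is trivial, so the exponent [i + q * j] collapses to
   [i + j]. *)
have -> : \sum_l w l * ((\matrix_(i < 3, l < N.+1) x l ^+ i) i l
      * (\matrix_(i < 3, l < N.+1) x l ^+ i) j l ^+ q)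
    = \sum_l x l ^+ (N - 4 + i + j) / (node_poly x l).[x l].
  apply: eq_bigr => l _; rewrite !mxE /w [x l ^+ j ^+ q]exprAC xq !exprD.
  by rewrite mulrAC mulrA.
have q0 : (0 < q)%N by lia.
rewrite sum_node_expr //; last by case: i j => [i iP] [j jP] /=; lia.
(* The top moment [N] is reached only for [i + j = 4], that is, at (2, 2). *)
rewrite natr_expq // mul1r -natrM mulnb; congr (_%:R); congr nat_of_bool.
rewrite -!(inj_eq val_inj) /= inordK //.
by case: i j => [i iP] [j jP] /=; lia.
Qed.

End Subfield.

(** * Assembly of the cases *)

Section PrimePower.

Variables (F : finFieldType) (q : nat).
Hypotheses (hq : prime_power q) (cF : #|F| = (q ^ 2)%N).

Lemma prime_power_pnat : [pchar F].-nat q.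
Proof.
have [p [e [pP e0 qE]]] := hq.
have pF : p \in [pchar F] by apply: (@card_finPcharP _ _ (e * 2)); rewrite // cF qE expnM.
by rewrite qE pnatX pnatE ?pF.
Qed.

Lemma dvd_succ_code N : (N %| q.+1)%N -> (4 <= N)%N ->
  exists C : {vspace 'rV[F]_N.+1},
    [/\ is_code_ge C 3 (N.+1 - 2), MDS C & \dim (herm_hull q C) = 2].
Proof.
move=> Nq N4; have qF := prime_power_pnat.
have [small|large] := ltnP N.+1 q; first exact: subfield_code.
(* A proper divisor of [q.+1] that is at least [q - 1] would force [q] to be at most 3, against [N]
   being at least 4. *)
have NE : N = q.+1.
  have /dvdnP[m mE] := Nq; case: m mE => [|[|m]]; first by lia.
    by lia.
  by move=> ?; nia.
have [qo|qe] := boolP (odd q).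
  have [N6|N6] := leqP 6 N; first by apply: even_circle_code; rewrite // NE /= qo.
  have [q3 N4'] : q = 3%N /\ N = 4%N by lia.
  by rewrite q3 N4'; apply: card9_code; rewrite cF q3.
have [N3|N3] := boolP (3 %| N)%N.
  by apply: cubic_circle_code => //; lia.
by apply: nucleus_code => //; rewrite coprime_sym prime_coprime.
Qed.

Lemma succ_length_code N k : (N %| q ^ 2 - 1)%N -> (0 < k)%N ->
  (k * q.+1 <= N + q)%N -> (2 * k + 2 <= N)%N ->
  (N %| (k + 1) * q.+1)%N \/ (N %| k * q.+1)%N ->
  exists C : {vspace 'rV[F]_N.+1},
    [/\ is_code_ge C (k + 2) (N.+1 - k - 1), MDS C
      & \dim (herm_hull q C) = (k + 1)%N].
Proof.
move=> dN k0 kN room or_k.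
have q1 := card_gt1_base cF; have qF := prime_power_pnat.
rewrite -subnDA.
have [[k1 Nq]|[d dk diag]] := exponent_cases q1 k0 kN room dN or_k.
  have -> : (k + 2 = 3)%N by lia.
  have -> : (k + 1 = 2)%N by lia.
  by apply: dvd_succ_code => //; lia.
have -> : (k + 2 = (k + 1).+1)%N by lia.
exact: diag_exponents_code dN room dk diag.
Qed.

End PrimePower.

Theorem corollary3 (q : nat) (F : finFieldType) (n k : nat)
    (hq : prime_power q) (hF : #|F| = (q ^ 2)%N)
    (hn : (0 < n)%N)
    (hdvd : (n - 1 %| q ^ 2 - 1)%N)
    (hk1 : (1 <= k)%N)
    (hk2 : (k <= (n + q - 1) %/ (q + 1))%N)
    (* Hull_H(C) has dimension k+1 and lies in the dual, of dimension n-(k+2) *)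
    (hroom : ((k + 1) + (k + 2) <= n)%N)
    (hor : (n - 1 %| (k + 1) * (q + 1))%N \/ (n - 1 %| k * (q + 1))%N) :
  exists C : {vspace 'rV[F]_n},
    [/\ is_code_ge C (k + 2) (n - k - 1), MDS C
      & \dim (herm_hull q C) = (k + 1)%N].
Proof.
have [N nE] : exists N, n = N.+1 by exists n.-1; rewrite prednK.
subst n; rewrite subn1 in hdvd hor; rewrite [(q + 1)%N]addn1 in hor.
apply: succ_length_code => //.
(* The floor bound on [k] becomes [k * q.+1 <= N + q]. *)
- by move: hk2; rewrite leq_divRL ?addn1 // addSn subn1.
- by lia.
Qed.
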